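(* Let $X$ be a $T_1$ topological space. The following conditions are equivalent. (1) $X$ is not countably compact. (2) $X$ is not $[\mathcal P(A)\setminus\{A\}, A]$-compact, for every countable nonempty set $A$. (3) $X$ is not $[B, A]$-compact, for some countably infinite set $A$ and some $B\subseteq \mathcal P(A)$ such that $B$ contains all finite subsets of $A$.
   Context: $\mathcal P(A)$ denotes the set of all subsets of $A$. If $A$ is a set and $B\subseteq\mathcal P(A)$, a topological space $X$ is $[B,A]$-compact if and only if, whenever $(O_a)_{a\in A}$ is a sequence (indexed family) of open sets of $X$ such that $\bigcup_{a\in A}O_a=X$, there is $H\in B$ such that $\bigcup_{a\in H}O_a=X$. Countably compact means that every countable open cover has a finite subcover; no separation axiom is included in this notion. In (2), finite nonempty sets count as countable. *)

(* Defs.v *)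
From mathcomp Require Import all_boot.
From mathcomp Require Import all_classical topology.

Set Implicit Arguments.
Unset Strict Implicit.
Unset Printing Implicit Defensive.

Local Open Scope classical_set_scope.

Definition power_set (I : Type) (A : set I) : set (set I) :=
  [set H | H `<=` A].

(* [A] is a subset of an ambient type [I] and [B] is meant to satisfy
   [B `<=` power_set A]; the values of the family [O] outside [A] are then
   irrelevant. *)
Definition BA_compact (I : Type) (B : set (set I)) (A : set I)
    (X : topologicalType) : Prop :=
  forall O : I -> set X,
    (forall a, A a -> open (O a)) ->
    \bigcup_(a in A) O a = [set: X] ->
    exists2 H : set I, B H & \bigcup_(a in H) O a = [set: X].

Definition countably_compact (X : topologicalType) : Prop :=
  forall U : set (set X),
    countable U ->
    (forall V, U V -> open V) ->
    \bigcup_(V in U) V = [set: X] ->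
    exists F : set (set X),
      [/\ F `<=` U, finite_set F & \bigcup_(V in F) V = [set: X]].

(* Main.v *)
Require Import Defs.
From mathcomp Require Import all_boot.
From mathcomp Require Import all_classical topology.

(** A T1 space that fails to be countably compact contains a countably
    infinite set all of whose subsets are closed.  Indeed a countable open
    cover without finite subcover yields an increasing open exhaustion by
    proper subsets; a sequence of points that leaves the exhaustion at ever
    later stages meets each stage in finitely many points, and finite sets
    are closed ([closed_sequence]).

    Label distinct points of that set by the elements of a given countable
    nonempty [A], say [y a] for [a] in [A], and let [O a] be the complement
    of all labelled points other than [y a].  These open sets cover the
    space, but [y a] lies in [O a] only, so no proper subfamily covers
    ([irreducible_open_cover]).  Taking for [A] the infinite set of natural
    numbers, the finite subsets are among the proper ones, so the family of
    proper subsets witnesses the last condition.  Conversely, in a countably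
    compact space every countable indexed open cover has a finite indexed
    subcover ([countably_compact_finite_subfamily]), hence one indexed by a
    member of any family that contains the finite subsets. *)

Local Open Scope classical_set_scope.

Lemma finite_subset_image (T U : Type) (f : T -> U) (A : set T) (F : set U) :
  finite_set F -> F `<=` f @` A ->
  exists H : set T, [/\ H `<=` A, finite_set H & f @` H = F].
Proof.
move=> finF FA; have [[a0 Aa0]|A0] := pselect (A !=set0); last first.
  exists set0; split=> //; rewrite image_set0; apply/esym/seteqP; split=> // v.
  by move=> /FA[a Aa _]; apply: A0; exists a.
have /choice[g gP] : forall v, exists a, A a /\ (F v -> f a = v).
  move=> v; have [/FA[a Aa <-]|nFv] := pselect (F v); first by exists a.
  by exists a0.
exists (g @` F); split; [|exact: finite_image|].
  by move=> _ [v _ <-]; exact: (gP v).1.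
apply/seteqP; split=> [_ [_ [v Fv <-] <-]|v Fv]; first by rewrite (gP v).2.
by exists (g v); [exists v|exact: (gP v).2].
Qed.

Lemma countably_compact_finite_subfamily (X : topologicalType) (I : Type)
    (A : set I) (O : I -> set X) :
  countably_compact X -> countable A -> (forall a, A a -> open (O a)) ->
  \bigcup_(a in A) O a = [set: X] ->
  exists H : set I,
    [/\ H `<=` A, finite_set H & \bigcup_(a in H) O a = [set: X]].
Proof.
move=> ccX cA oO covO.
have [||| F [FA finF covF]] := ccX (O @` A).
- exact: (card_le_trans (card_image_le _ _) cA).
- by move=> _ [a Aa <-]; exact: oO.
- by rewrite bigcup_image.
have [H [HA finH HF]] := finite_subset_image _ _ O A F finF FA.
by exists H; split=> //; rewrite -covF -HF bigcup_image.
Qed.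

(** The [n]-th stage is the union of the members numbered below [n] in a
    countable open cover without finite subcover. *)
Lemma open_exhaustion (X : topologicalType) :
  ~ countably_compact X ->
  exists W : nat -> set X,
    [/\ forall n, open (W n),
        forall m n, m <= n -> W m `<=` W n,
        forall x, exists n, W n x
      & forall n, exists x, ~ W n x].
Proof.
move=> /existsNP[U /not_implyP[/countable_injP[f finj]]].
move=> /not_implyP[oU /not_implyP[covU nfin]].
pose G n := U `&` [set V | f V < n].
exists (fun n => \bigcup_(V in G n) V); split=> [n|m n mn x|x|n].
- by apply: bigcup_open => V [UV _]; exact: oU.
- by move=> [V [UV /= fV] Vx]; exists V => //; split=> //; exact: leq_trans mn.
- have : [set: X] x by [].
  by rewrite -covU => -[V UV Vx]; exists (f V).+1, V => //; split=> /=.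
- apply/existsNP => cov; apply: nfin; exists (G n); split; first by move=> V [].
  + have finI : finite_set (f @` G n).
      by apply: sub_finite_set (finite_II n) => _ [V [_ fV] <-].
    rewrite -(eq_finite_set (A := f @` G n)) //; apply: inj_card_eq.
    move=> V V' /set_mem[UV _] /set_mem[UV' _]; apply: finj; exact/mem_set.
  + by apply/seteqP; split=> // x _; exact: cov.
Qed.

(** The points are chosen along stages [k n] of an exhaustion, the [n]-th
    point lying in stage [k n.+1] but not in stage [k n].  So stage [k n]
    contains only the points of index below [n], and removing finitely many of
    them from it leaves an open set. *)
Lemma closed_sequence (X : topologicalType) :
  accessible_space X -> ~ countably_compact X ->
  exists x : nat -> X, injective x /\ forall S : set nat, closed (x @` S).
Proof.
move=> T1X /open_exhaustion[W [oW Wmono /choice[r Wr] /choice[p nWp]]].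
pose k n := iter n (r \o p) 0.
have ltk n : k n < k n.+1.
  rewrite ltnNge; apply/negP => le_k; apply: (nWp (k n)).
  exact: Wmono _ _ le_k _ (Wr _).
have lek m n : m <= n -> k m <= k n.
  exact: (@homo_leq nat k leq leqnn leq_trans (fun i => ltnW (ltk i))).
have lenk n : n <= k n.
  by elim: n => // n IHn; exact: leq_ltn_trans IHn (ltk n).
pose x n := p (k n).
have Wx m n : W (k n) (x m) <-> m < n.
  split=> [Wkx|mn]; last exact: Wmono _ _ (lek _ _ mn) _ (Wr _).
  rewrite ltnNge; apply/negP => nm.
  by apply: (nWp (k m)); exact: Wmono _ _ (lek _ _ nm) _ Wkx.
exists x; split=> [m n xmn|S].
  apply/eqP; rewrite eqn_leq -!(ltnS m) -!(ltnS n).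
  by apply/andP; split; apply/Wx; [rewrite xmn|rewrite -xmn]; apply/Wx.
rewrite -openC.
have -> : ~` (x @` S) =
    \bigcup_n (W (k n) `&` ~` (x @` (S `&` [set m | m < n]))).
  apply/seteqP; split=> [y nSy|y [n _ [Wy nSy]] [m Sm xmy]].
    exists (r y) => //; split; first exact: Wmono _ _ (lenk _) _ (Wr y).
    by move=> [m [Sm _] xmy]; apply: nSy; exists m.
  by apply: nSy; exists m => //; split=> //; apply/Wx; rewrite xmy.
apply: bigcup_open => n _; apply: openI; first exact: oW.
apply: closed_openC; apply: accessible_finite_set_closed.1 => //.
by apply/finite_image/(sub_finite_set _ (finite_II n)) => m [].
Qed.

Lemma irreducible_open_cover (X : topologicalType) (I : Type) (A : set I) :
  accessible_space X -> ~ countably_compact X -> countable A -> A !=set0 ->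
  exists O : I -> set X,
    [/\ forall a, A a -> open (O a),
        \bigcup_(a in A) O a = [set: X]
      & forall H, H `<=` A -> \bigcup_(a in H) O a = [set: X] -> H = A].
Proof.
move=> T1X nccX /countable_injP[f finj] [a0 Aa0].
have [x [xinj xcl]] := closed_sequence X T1X nccX.
pose y a := x (f a).
have yinj a b : A a -> A b -> y a = y b -> a = b.
  by move=> Aa Ab /xinj; apply: finj; exact/mem_set.
exists (fun a => ~` (y @` (A `&` [set b | b <> a]))); split=> [a _||H HA covH].
- by apply: closed_openC; rewrite -image_comp; exact: xcl.
- apply/seteqP; split=> // z _.
  have [[a Aa yaz]|nyz] := pselect ((y @` A) z).
    exists a => // -[b [Ab nba] ybz]; apply: nba; apply: yinj => //.
    by rewrite ybz.
  (* an unlabelled point lies in every member of the cover *)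
  by exists a0 => // -[b [Ab _] ybz]; apply: nyz; exists b.
- apply/seteqP; split=> // a Aa.
  have : [set: X] (y a) by [].
  rewrite -covH => -[b Hb nya].
  have [<- //|nba] := pselect (b = a).
  by exfalso; apply: nya; exists a => //; split=> //; exact/nesym.
Qed.

Theorem proposition1p4 (X : topologicalType) (X_T1 : accessible_space X) :
  [<-> ~ countably_compact X;
       forall (I : Type) (A : set I), countable A -> A !=set0 ->
         ~ BA_compact (power_set A `\ A) A X;
       exists (I : Type) (A : set I) (B : set (set I)),
         [/\ countable A, infinite_set A, B `<=` power_set A,
             (forall H : set I, H `<=` A -> finite_set H -> B H)
           & ~ BA_compact B A X]].
Proof.
tfae.
- move=> nccX I A cA A0 cX.
  have [O [oO covO irrO]] := irreducible_open_cover X I A X_T1 nccX cA A0.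
  by have [H [HA neHA] covH] := cX O oO covO; apply: neHA; exact: irrO.
- move=> ncX; exists nat, [set: nat], (power_set [set: nat] `\ [set: nat]).
  split=> //.
  + exact: infinite_nat.
  + by move=> H HT finH; split=> // HE; apply: infinite_nat; rewrite -HE.
  + by apply: (ncX nat) => //; exists 0.
- move=> [I [A [B [cA _ _ finB ncX]]]] ccX; apply: ncX => O oO covO.
  have [H [HA finH covH]] :=
    countably_compact_finite_subfamily X I A O ccX cA oO covO.
  by exists H => //; exact: finB.
Qed.
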